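(* Let $\Lambda_2=\mathbb{C}\langle x,y\rangle/(yx-xy-y^2)$ be the Jordanian plane over $\mathbb{C}$. Then the Arens-Michael envelope of $\Lambda_2$ is (topologically isomorphic, via the map sending $x\mapsto x$, $y\mapsto y$, to) $$\widehat{\Lambda}_2=\Big\{a=\sum_{i,j=0}^\infty a_{ij}x^iy^j\ :\ \|a\|_\rho=\sum_{i,j=0}^\infty|a_{ij}|\frac{\rho^{i+j}}{j!}<\infty\ \text{ for every }\rho>0\Big\},$$ with the topology given by the family of seminorms $\{\|\cdot\|_\rho:\rho>0\}$ and with the (continuous) multiplication determined by the relation $yx=xy+y^2$, i.e. extending the multiplication of $\Lambda_2$ on the dense subspace of finite sums.
   Context: An Arens-Michael algebra is a complete locally convex topological algebra (over $\mathbb{C}$, associative, unital) whose topology is defined by a family of submultiplicative seminorms ($\|ab\|\le\|a\|\|b\|$). For an algebra $A$ without topology, endow $A$ with the strongest locally convex topology; its Arens-Michael envelope is a pair $(\widehat A,\iota_A)$ consisting of an Arens-Michael algebra $\widehat A$ and a continuous homomorphism $\iota_A:A\to\widehat A$ such that for every Arens-Michael algebra $B$ and every continuous homomorphism $\varphi:A\to B$ there is a unique continuous homomorphism $\widehat\varphi:\widehat A\to B$ with $\widehat\varphi\circ\iota_A=\varphi$. (Equivalently, $\widehat A$ is the Hausdorff completion of $A$ with respect to all submultiplicative seminorms.) The monomials $x^iy^j$ ($i,j\ge0$) form a basis of $\Lambda_2$. *)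

(* Defs.v *)
From HB Require Import structures.
From mathcomp Require Import all_boot all_order all_algebra.
From mathcomp Require Import complex.
From mathcomp Require Import boolp classical_sets functions reals.
From Stdlib Require List.

Set Implicit Arguments.
Unset Strict Implicit.
Unset Printing Implicit Defensive.

Import Order.TTheory GRing.Theory Num.Theory.
Local Open Scope ring_scope.

Definition absC {R : realType} (z : R[i]) : R := ComplexField.Normc.normc z.

Section Seminorms.
Context {R : realType} {V : lmodType R[i]}.

Definition seminorm (p : V -> R) : Prop :=
  [/\ forall a, 0 <= p a,
      forall a b, p (a + b) <= p a + p b &
      forall (k : R[i]) a, p (k *: a) = absC k * p a].

Definition sn_open {I : Type} (p : I -> V -> R) (U : V -> Prop) : Prop :=
  forall a, U a -> exists (s : seq I) (e : R), 0 < e /\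
    (forall b, (forall i, List.In i s -> p i (b - a) < e) -> U b).

Definition same_topology {I J : Type} (p : I -> V -> R) (q : J -> V -> R) :=
  forall U : V -> Prop, sn_open p U <-> sn_open q U.

Definition sn_hausdorff {I : Type} (p : I -> V -> R) : Prop :=
  forall a, (forall i, p i a = 0) -> a = 0.

Definition is_filter (F : (V -> Prop) -> Prop) : Prop :=
  [/\ F (fun _ => True),
      forall S T, F S -> F T -> F (fun a => S a /\ T a) &
      forall S T : V -> Prop, (forall a, S a -> T a) -> F S -> F T].

Definition sn_cauchy {I : Type} (p : I -> V -> R) (F : (V -> Prop) -> Prop) :=
  forall i (e : R), 0 < e ->
    exists S, F S /\ forall a b, S a -> S b -> p i (a - b) < e.

Definition sn_converges {I : Type} (p : I -> V -> R) (F : (V -> Prop) -> Prop)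
  (l : V) := forall U, sn_open p U -> U l -> F U.

Definition sn_complete {I : Type} (p : I -> V -> R) : Prop :=
  forall F, is_filter F -> sn_cauchy p F -> exists l, sn_converges p F l.

Definition is_AM (mul : V -> V -> V) {I : Type} (p : I -> V -> R) : Prop :=
  [/\ forall i, seminorm (p i),
      sn_hausdorff p,
      sn_complete p &
      exists (J : Type) (q : J -> V -> R),
        [/\ forall j, seminorm (q j),
            forall j a b, q j (mul a b) <= q j a * q j b &
            same_topology p q]].

End Seminorms.

Definition sn_continuous {R : realType} {V W : lmodType R[i]} {I J : Type}
  (p : I -> V -> R) (q : J -> W -> R) (f : V -> W) : Prop :=
  forall U : W -> Prop, sn_open q U -> sn_open p (fun a => U (f a)).

(* (a_ij is the coefficient of x^i y^j).                               *)

(* coefficient families, with the pointwise complex vector space structure *)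
Notation coefs R := (nat -> nat -> (R[i])^o).

Section Aspace.
Variable R : realType.


Definition wt (rho : R) (i j : nat) : R := rho ^+ (i + j) / (j`!)%:R.

Definition partial_sum (rho : R) (a : coefs R) (N : nat) : R :=
  \sum_(i < N) \sum_(j < N) absC (a i j) * wt rho i j.

(* the (nonnegative) double series converges, i.e. its partial sums
   are bounded, for every rho > 0 *)
Definition inA (a : coefs R) : Prop :=
  forall rho : R, 0 < rho -> exists M : R, forall N, partial_sum rho a N <= M.

(* ||a||_rho = the sum of the series = sup of its partial sums *)
Definition normA (rho : R) (a : coefs R) : R := sup (range (partial_sum rho a)).

Definition inAb (a : coefs R) : bool := `[< inA a >].

Lemma absC_ge0 (z : R[i]) : 0 <= absC z.
Proof. by case: z => a b; rewrite /absC /= sqrtr_ge0. Qed.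

Lemma absC_add (z w : R[i]) : absC (z + w) <= absC z + absC w.
Proof. exact: (@le_normcD R z w). Qed.

Lemma absC_mul (z w : R[i]) : absC (z * w) = absC z * absC w.
Proof. exact: ComplexField.Normc.normcM. Qed.

Lemma absC0 : absC (0 : R[i]) = 0.
Proof. exact: ComplexField.Normc.normc0. Qed.

Lemma wt_ge0 rho i j : 0 < rho -> 0 <= wt rho i j.
Proof.
move=> r0; rewrite /wt; apply: divr_ge0; first by rewrite exprn_ge0 // ltW.
exact: ler0n.
Qed.

Lemma inA_submod_closed : @GRing.submod_closed R[i] (coefs R) inAb.
Proof.
split.
- apply/asboolP => rho r0; exists 0 => N.
  rewrite /partial_sum big1 // => i _; rewrite big1 // => j _.
  by rewrite [absC _](_ : _ = 0) ?mul0r //; exact: absC0.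
- move=> a u v /asboolP Hu /asboolP Hv; apply/asboolP => rho r0.
  have [Mu HMu] := Hu rho r0; have [Mv HMv] := Hv rho r0.
  exists (absC a * Mu + Mv) => N.
  apply: (le_trans (y := absC a * partial_sum rho u N + partial_sum rho v N)).
    rewrite /partial_sum mulr_sumr -big_split /=; apply: ler_sum => i _.
    rewrite mulr_sumr -big_split /=; apply: ler_sum => j _.
    rewrite mulrA -mulrDl ler_wpM2r ?wt_ge0 //.
    apply: (le_trans (absC_add _ _)).
    by rewrite lerD2r /= absC_mul.
  by rewrite lerD // ler_wpM2l ?absC_ge0.
Qed.

HB.instance Definition _ :=
  GRing.isSubmodClosed.Build R[i] (coefs R) inAb inA_submod_closed.

Record Aspace := ASub { aval : coefs R; avalP : inAb aval }.

HB.instance Definition _ := [isSub for aval].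
HB.instance Definition _ := [Choice of Aspace by <:].
HB.instance Definition _ := [SubChoice_isSubZmodule of Aspace by <:].
HB.instance Definition _ := [SubZmodule_isSubLmodule of Aspace by <:].

Definition posR := {rho : R | 0 < rho}.

Definition normAs (rho : posR) (a : Aspace) : R := normA (sval rho) (aval a).

(* coefficient family of the monomial x^i y^j *)
Definition delta (i j : nat) : coefs R :=
  fun k l => if (k == i) && (l == j) then 1 else 0.

End Aspace.

(* Main.v *)
(** The right multiplications by [x] and [y] on the monomial basis,
    [x^i y^j * y = x^i y^(j+1)] and [x^i y^j * x = x^(i+1) y^j + j x^i y^(j+1)],
    are bounded for every norm [||.||_rho], with
    [||a y^l||_rho <= rho^l / l! ||a||_rho] and [||a x||_rho <= 2 rho ||a||_rho].
    Hence [b |-> a b] extends from monomials to the whole space with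
    [||a b||_rho <= ||a||_rho ||b||_(2 rho)], and every identity between continuous
    linear maps need only be checked on monomials.  The operator norm of right
    multiplication by [b] on the space normed by [||.||_rho] is submultiplicative and
    lies between [||b||_rho] and [||b||_(2 rho)], so the topology is Arens-Michael.

    For the universal property let [Y X = X Y + Y^2] in an algebra with a
    submultiplicative seminorm [q].  Then [j Y^(j+1) = Y^j X - X Y^j], hence
    [j q(Y^(j+1)) <= 2 q(X) q(Y^j)] and [q(Y^j)] decays like [C^j / j!].  So
    [x^i y^j |-> X^i Y^j] extends continuously; this factorial decay is where the
    weights [1 / j!] come from. *)

Require Import Defs.
From HB Require Import structures.
From mathcomp Require Import all_boot all_order all_algebra.
From mathcomp Require Import complex.
From mathcomp Require Import boolp classical_sets functions reals.
From mathcomp Require Import ring lra.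
Import Order.TTheory GRing.Theory Num.Theory.
Local Open Scope ring_scope.

(** * Absolute value on the complex scalars *)

Section AbsC.
Variable R : realType.

Lemma absC_real (r : R) : absC (r%:C)%C = `|r|.
Proof. by rewrite /absC /= expr0n addr0 sqrtr_sqr. Qed.

Lemma absC_nat n : absC (n%:R : R[i]) = n%:R.
Proof.
have -> : (n%:R : R[i]) = (n%:R%:C)%C by rewrite raddfMn.
by rewrite absC_real ger0_norm.
Qed.

Lemma absC1 : absC (1 : R[i]) = 1.
Proof. exact: (absC_nat 1). Qed.

Lemma absCN (z : R[i]) : absC (- z) = absC z.
Proof. by case: z => a b; rewrite /absC /= !sqrrN. Qed.

Lemma absC_eq0 (z : R[i]) : absC z = 0 -> z = 0.
Proof. exact: ComplexField.Normc.eq0_normc. Qed.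

Lemma absCV (z : R[i]) : absC z^-1 = (absC z)^-1.
Proof. exact: ComplexField.Normc.normcV. Qed.

Lemma absC_le_ReIm (z : R[i]) : absC z <= `|complex.Re z| + `|complex.Im z|.
Proof.
case: z => a b.
rewrite [leLHS](_ : _ = absC ((a +i* 0)%C + (0 +i* b)%C)); last first.
  by congr absC; apply/eqP; rewrite eq_complex /= addr0 add0r !eqxx.
apply: le_trans (absC_add _ _) _.
by rewrite /absC /= !expr0n /= addr0 add0r !sqrtr_sqr.
Qed.

Lemma Re_le_absC (z : R[i]) : `|complex.Re z| <= absC z.
Proof.
case: z => a b; rewrite /absC /= -sqrtr_sqr ler_wsqrtr // lerDl; exact: sqr_ge0.
Qed.

Lemma Im_le_absC (z : R[i]) : `|complex.Im z| <= absC z.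
Proof.
case: z => a b; rewrite /absC /= -[leLHS]sqrtr_sqr ler_wsqrtr // lerDr; exact: sqr_ge0.
Qed.

End AbsC.

(** * Seminorm topologies *)

Section SeminormTheory.
Context {R : realType} {V : lmodType R[i]}.
Implicit Types p : V -> R.

Lemma seminorm_ge0 {p} : seminorm p -> forall a, 0 <= p a.
Proof. by case. Qed.

Lemma seminormD {p} : seminorm p -> forall a b, p (a + b) <= p a + p b.
Proof. by case. Qed.

Lemma seminormZ {p} : seminorm p -> forall (k : R[i]) a, p (k *: a) = absC k * p a.
Proof. by case. Qed.

Lemma seminorm0 {p} : seminorm p -> p 0 = 0.
Proof. by move=> sp; rewrite -(scale0r (0 : V)) (seminormZ sp) absC0 mul0r. Qed.

Lemma seminormN {p} : seminorm p -> forall a, p (- a) = p a.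
Proof. by move=> sp a; rewrite -scaleN1r (seminormZ sp) absCN absC1 mul1r. Qed.

Lemma seminormB {p} : seminorm p -> forall a b, p (a - b) <= p a + p b.
Proof. by move=> sp a b; rewrite -(seminormN sp b) seminormD. Qed.

Lemma seminormC {p} : seminorm p -> forall a b, p (a - b) = p (b - a).
Proof. by move=> sp a b; rewrite -(seminormN sp) opprB. Qed.

Lemma seminorm_sum {p} : seminorm p -> forall I (r : seq I) (P : pred I) (F : I -> V),
  p (\sum_(i <- r | P i) F i) <= \sum_(i <- r | P i) p (F i).
Proof.
move=> sp I r P F; elim/big_rec2: _ => [|i x y _ h]; first by rewrite seminorm0.
by apply: le_trans (seminormD sp _ _) _; rewrite lerD2l.
Qed.

(** For nonzero [k], applying the inequality to [k^-1] and [k *: a] gives the reverse one, so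
    homogeneity needs only an upper bound. *)
Lemma seminormP p : (forall a, 0 <= p a) -> (forall a b, p (a + b) <= p a + p b) ->
  (forall (k : R[i]) a, p (k *: a) <= absC k * p a) -> seminorm p.
Proof.
move=> p0 pD pZ; split=> // k a; apply/le_anti; rewrite pZ /=.
have [->|k0] := eqVneq k 0; first by rewrite absC0 mul0r.
have ak0 : 0 < absC k.
  rewrite lt_neqAle absC_ge0 andbT eq_sym; apply: contra_neq k0; exact: absC_eq0.
have := pZ k^-1 (k *: a); rewrite scalerA mulVf // scale1r absCV => h.
by rewrite mulrC -ler_pdivlMr // mulrC.
Qed.

Lemma sn_open_ball {I} {p : I -> V -> R} i (e : R) l : (forall i, seminorm (p i)) ->
  sn_open p (fun a => p i (a - l) < e).
Proof.
move=> sp a ha; exists [:: i], (e - p i (a - l)); rewrite subr_gt0; split=> // b hb.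
have := hb i (or_introl erefl).
have := seminormD (sp i) (b - a) (a - l); rewrite addrA subrK; lra.
Qed.

Lemma sn_converges_ball {I} {p : I -> V -> R} {F l} : (forall i, seminorm (p i)) ->
  sn_converges p F l -> forall i e, 0 < e -> F (fun a => p i (a - l) < e).
Proof.
by move=> sp cv i e e0; apply: cv; [exact: sn_open_ball | rewrite subrr seminorm0].
Qed.

Lemma ball_sn_converges {I} {p : I -> V -> R} {F l} : is_filter F ->
  (forall i e, 0 < e -> F (fun a => p i (a - l) < e)) -> sn_converges p F l.
Proof.
move=> [FT FI Fsub] h U oU Ul; have [s [e [e0 hU]]] := oU l Ul.
suff : F (fun a => forall i, List.In i s -> p i (a - l) < e) by apply: Fsub => a; apply: hU.
elim: s {hU} => [|i s IH]; first by apply: Fsub FT.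
apply: Fsub (FI _ _ (h i e e0) IH) => a [h1 h2] j /= [<-|]; [exact: h1|exact: h2].
Qed.

Lemma sn_eq0 {I} {p : I -> V -> R} : (forall i, seminorm (p i)) -> sn_hausdorff p ->
  forall a, (forall i e, 0 < e -> p i a < e) -> a = 0.
Proof.
move=> sp hp a h; apply: hp => i; apply/le_anti; rewrite seminorm_ge0 // andbT.
by rewrite leNgt; apply/negP => /[dup] /(h i); rewrite ltxx.
Qed.

Section SameTopology.
Context {I J : Type} {p : I -> V -> R} {q : J -> V -> R}.
Hypothesis sp : forall i, seminorm (p i).
Hypothesis pq : same_topology p q.

(** A [p i]-ball around 0 is open for [q] too, hence contains a basic [q]-neighbourhood of 0. This
    transfers the Hausdorff property and completeness to a submultiplicative family defining the
    same topology. *)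
Lemma same_topology_dominated i e : 0 < e -> exists (s : seq J) (d : R), 0 < d /\
  forall a, (forall j, List.In j s -> q j a < d) -> p i a < e.
Proof.
move=> e0; have /pq := sn_open_ball i e 0 sp; move/(_ 0).
rewrite subrr seminorm0 // => /(_ e0) [s [d [d0 h]]]; exists s, d; split=> // a ha.
by have := h a; rewrite !subr0; apply.
Qed.

Lemma same_topology_hausdorff : sn_hausdorff p -> sn_hausdorff q.
Proof.
move=> hp a ha; apply: (sn_eq0 sp hp) => i e e0.
have [s [d [d0 h]]] := same_topology_dominated i e e0.
by apply: h => j _; rewrite ha.
Qed.

Lemma same_topology_complete : sn_complete p -> sn_complete q.
Proof.
move=> cp F fF cF; have [|l hl] := cp F fF; last first.
  by exists l => U oU; apply: hl; apply/pq.
move=> i e e0; have [s [d [d0 h]]] := same_topology_dominated i e e0.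
have [FT FI Fsub] := fF.
(* Intersecting finitely many Cauchy sets of the filter yields one set that is small for all
   seminorms in [s]. *)
have [S [FS hS]] : exists S, F S /\
    forall a b, S a -> S b -> forall j, List.In j s -> q j (a - b) < d.
  elim: s {h} => [|j s [S [FS hS]]]; first by exists (fun=> True).
  have [T [FT' hT]] := cF j d d0; exists (fun a => S a /\ T a); split; first exact: FI.
  move=> a b [Sa Ta] [Sb Tb] k /= [<-|]; [exact: hT|exact: hS].
by exists S; split=> // a b Sa Sb; apply: h => j; apply: hS.
Qed.

End SameTopology.

End SeminormTheory.

(** * Continuity of linear maps between seminormed spaces *)

Section Continuity.
Context {R : realType} {V W : lmodType R[i]} {I J : Type}.
Context {p : I -> V -> R} {q : J -> W -> R} {f : V -> W}.

(** The epsilon-delta form of continuity at 0; for additive maps, translation makes it equivalent to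
    continuity by open sets. *)
Definition sn_continuous0 : Prop := forall j e, 0 < e ->
  exists (s : seq I) (d : R), 0 < d /\
  forall a, (forall i, List.In i s -> p i a < d) -> q j (f a) < e.

Lemma sn_continuous0_continuous : {morph f : a b / a - b} -> sn_continuous0 ->
  sn_continuous p q f.
Proof.
move=> fB cf U oU a Ua; have [s [e [e0 hU]]] := oU _ Ua.
(* The neighbourhoods obtained for the finitely many [j] in [s] are merged: concatenate the lists of
   seminorms, take the minimum of the radii. *)
have [s' [e' [e'0 h]]] : exists (s' : seq I) (e' : R), 0 < e' /\
   forall b, (forall i, List.In i s' -> p i b < e') ->
   forall j, List.In j s -> q j (f b) < e.
  elim: s {hU} => [|j s [s' [e' [e'0 h]]]]; first by exists [::], 1.
  have [t [d [d0 ht]]] := cf j e e0.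
  exists (t ++ s'), (Num.min e' d); rewrite lt_min e'0 d0; split=> // b hb k /= [<-|ks].
    apply: ht => i it; have := hb i; rewrite lt_min => /(_ _)/andP[] //.
    by apply/List.in_app_iff; left.
  apply: h => // i it; have := hb i; rewrite lt_min => /(_ _)/andP[] //.
  by apply/List.in_app_iff; right.
by exists s', e'; split=> // b hb; apply: hU => j js; rewrite -fB; apply: h.
Qed.

Lemma bounded_sn_continuous : {morph f : a b / a - b} ->
  (forall j, exists i C, forall a, q j (f a) <= C * p i a) ->
  (forall i a, 0 <= p i a) -> sn_continuous p q f.
Proof.
move=> fB bf p0; apply: sn_continuous0_continuous => // j e e0.
have [i [C hC]] := bf j.
(* [C] may be zero or negative, so the radius is divided by [|C| + 1]. *)
have C1 : 0 < `|C| + 1 by rewrite ltr_wpDl.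
exists [:: i], (e / (`|C| + 1)); split; first by rewrite divr_gt0.
move=> a /(_ i (or_introl erefl)); rewrite ltr_pdivlMr // => hlt.
apply: le_lt_trans hlt; apply: le_trans (hC _) _.
by rewrite mulrC ler_wpM2l // (le_trans (ler_norm _)) // lerDl.
Qed.

Lemma sn_continuous_at0 : (forall j, seminorm (q j)) -> sn_continuous p q f -> f 0 = 0 ->
  sn_continuous0.
Proof.
move=> sq cf f0 j e e0; have /cf /(_ 0) := sn_open_ball j e 0 sq.
rewrite f0 subrr seminorm0 // => /(_ e0) [s [d [d0 h]]]; exists s, d; split=> // a ha.
by have := h a; rewrite !subr0; apply.
Qed.

End Continuity.

Section LinearCombinations.
Context {R : realType} {V W : lmodType R[i]} {I J : Type}.
Context {p : I -> V -> R} {q : J -> W -> R}.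
Hypothesis sq : forall j, seminorm (q j).

Lemma sn_continuousD (f g : {linear V -> W}) : sn_continuous p q f -> sn_continuous p q g ->
  sn_continuous p q (f \+ g).
Proof.
move=> cf cg; apply: sn_continuous0_continuous => [a b|j e e0]; first by rewrite raddfB.
have e20 : 0 < e / 2 by lra.
have [s [d [d0 hf]]] := sn_continuous_at0 sq cf (raddf0 f) j _ e20.
have [t [c [c0 hg]]] := sn_continuous_at0 sq cg (raddf0 g) j _ e20.
exists (s ++ t), (Num.min d c); rewrite lt_min d0 c0; split=> // a ha /=.
have h1 : q j (f a) < e / 2.
  apply: hf => i it; have := ha i; rewrite lt_min => /(_ _)/andP[] //.
  by apply/List.in_app_iff; left.
have h2 : q j (g a) < e / 2.
  apply: hg => i it; have := ha i; rewrite lt_min => /(_ _)/andP[] //.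
  by apply/List.in_app_iff; right.
by apply: le_lt_trans (seminormD (sq j) _ _) _; lra.
Qed.

Lemma sn_continuousZ (k : R[i]) (f : {linear V -> W}) : sn_continuous p q f ->
  sn_continuous p q (k \*: f).
Proof.
move=> cf; apply: sn_continuous0_continuous => [a b|j e e0]; first by rewrite raddfB.
have k1 : 0 < absC k + 1 by rewrite ltr_wpDl ?absC_ge0.
have [s [d [d0 h]]] := sn_continuous_at0 sq cf (raddf0 f) j _ (divr_gt0 e0 k1).
exists s, d; split=> // a /h; rewrite ltr_pdivlMr //= seminormZ //; apply: le_lt_trans.
by rewrite mulrC ler_wpM2l ?seminorm_ge0 // lerDl.
Qed.

End LinearCombinations.

Lemma sn_continuous_comp {R : realType} {U V W : lmodType R[i]} {I J K : Type}
    {p : I -> U -> R} {q : J -> V -> R} {r : K -> W -> R} {f : V -> W} {g : U -> V} :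
  sn_continuous q r f -> sn_continuous p q g -> sn_continuous p r (f \o g).
Proof. by move=> cf cg S oS; apply: (cg (S \o f)); apply: cf. Qed.

(** * Limits of scalar functions along a proper filter *)

Section FilterLimits.
Context {R : realType} {V : lmodType R[i]} {F : (V -> Prop) -> Prop}.
Hypotheses (fF : is_filter F) (nF : ~ F (fun=> False)).

Lemma filter_ex S : F S -> exists a, S a.
Proof.
move=> FS; apply: contrapT => nS; apply: nF; have [_ _ Fsub] := fF.
by apply: Fsub FS => a Sa; apply: nS; exists a.
Qed.

Lemma filter_real_limit (g : V -> R) :
  (forall e, 0 < e -> exists S, F S /\ forall a b, S a -> S b -> `|g a - g b| < e) ->
  exists L, forall e, 0 < e -> F (fun a => `|g a - L| < e).
Proof.
move=> cg; have [FT FI Fsub] := fF.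
(* The limit is the supremum of the levels that [g] eventually exceeds. If [g] oscillates by less
   than [e] on a set of the filter, each value [g a] there has [g a - e] in [E] and [g a + e] as an
   upper bound of [E]. *)
pose E := [set r : R | F (fun a => r <= g a)]%classic.
have ubE e S a : (forall a b, S a -> S b -> `|g a - g b| < e) -> F S -> S a ->
    ubound E (g a + e).
  move=> hS FS Sa r Er; have [b [Sb rb]] := filter_ex _ (FI _ _ FS Er).
  by have := hS _ _ Sa Sb; rewrite ltr_norml => /andP[h1 h2]; lra.
have lbE e S a : (forall a b, S a -> S b -> `|g a - g b| < e) -> F S -> S a ->
    E (g a - e).
  move=> hS FS Sa; apply: Fsub FS => b Sb.
  by have := hS _ _ Sa Sb; rewrite ltr_norml => /andP[h1 h2]; lra.
exists (sup E) => e e0; have e20 : 0 < e / 2 by lra.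
have [S [FS hS]] := cg _ e20; have [a Sa] := filter_ex _ FS.
have u := ubE _ _ _ hS FS Sa; have l := lbE _ _ _ hS FS Sa.
have FS0 := FS; apply: Fsub FS => b Sb.
have h1 : g a - e / 2 <= sup E := ub_le_sup (ex_intro _ _ u) l.
have h2 : sup E <= g a + e / 2 := ge_sup (ex_intro _ _ l) u.
have h3 : g b - e / 2 <= sup E := ub_le_sup (ex_intro _ _ u) (lbE _ _ _ hS FS0 Sb).
have h4 : sup E <= g b + e / 2 := ge_sup (ex_intro _ _ l) (ubE _ _ _ hS FS0 Sb).
by rewrite ltr_norml; apply/andP; split; lra.
Qed.

Lemma filter_complex_limit (g : V -> R[i]) :
  (forall e, 0 < e -> exists S, F S /\ forall a b, S a -> S b -> absC (g a - g b) < e) ->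
  exists L, forall e, 0 < e -> F (fun a => absC (g a - L) < e).
Proof.
move=> cg; have [FT FI Fsub] := fF.
have ReB (z w : R[i]) : complex.Re (z - w) = complex.Re z - complex.Re w.
  by case: z; case: w.
have ImB (z w : R[i]) : complex.Im (z - w) = complex.Im z - complex.Im w.
  by case: z; case: w.
have [Lr hr] : exists L, forall e, 0 < e -> F (fun a => `|complex.Re (g a) - L| < e).
  apply: filter_real_limit => e /cg [S [FS h]]; exists S; split=> // a b Sa Sb.
  by rewrite -ReB; apply: le_lt_trans (Re_le_absC _ _) (h _ _ Sa Sb).
have [Li hi] : exists L, forall e, 0 < e -> F (fun a => `|complex.Im (g a) - L| < e).
  apply: filter_real_limit => e /cg [S [FS h]]; exists S; split=> // a b Sa Sb.
  by rewrite -ImB; apply: le_lt_trans (Im_le_absC _ _) (h _ _ Sa Sb).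
exists (Lr +i* Li)%C => e e0; have e20 : 0 < e / 2 by lra.
apply: Fsub (FI _ _ (hr _ e20) (hi _ e20)) => a [h1 h2].
by apply: le_lt_trans (absC_le_ReIm _ _) _; rewrite ReB ImB /=; lra.
Qed.

End FilterLimits.

(** * The coefficient space *)

Section CoefficientSpace.
Variable R : realType.
Implicit Types (a b : Aspace R) (rho : R) (i j k l N M : nat).

Definition acoef (i j : nat) (a : Aspace R) : R[i] := aval a i j.
Arguments acoef : simpl never.

Lemma acoefD i j a b : acoef i j (a + b) = acoef i j a + acoef i j b.
Proof. by []. Qed.

Lemma acoefB i j a b : acoef i j (a - b) = acoef i j a - acoef i j b.
Proof. by []. Qed.

Lemma acoefZ i j (k : R[i]) a : acoef i j (k *: a) = k * acoef i j a.
Proof. by []. Qed.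

Lemma acoef_sum i j I (r : seq I) (P : pred I) (F : I -> Aspace R) :
  acoef i j (\sum_(k <- r | P k) F k) = \sum_(k <- r | P k) acoef i j (F k).
Proof. exact: (big_morph (acoef i j) (acoefD i j) erefl). Qed.

Lemma Aspace_ext a b : (forall i j, acoef i j a = acoef i j b) -> a = b.
Proof. by move=> h; apply: val_inj; apply/funext => i; apply/funext => j; apply: h. Qed.

(** The same number as [normAs], with the radius unbundled from its positivity proof so that it can
    be computed with, as in [2 * rho]. *)
Definition nrm (rho : R) (a : Aspace R) : R := normA rho (aval a).

Lemma wt_gt0 rho i j : 0 < rho -> 0 < wt rho i j.
Proof. by move=> r0; rewrite divr_gt0 ?exprn_gt0 // ltr0n fact_gt0. Qed.

Lemma term_ge0 rho (c : coefs R) i j : 0 < rho -> 0 <= absC (c i j) * wt rho i j.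
Proof. by move=> r0; rewrite mulr_ge0 ?absC_ge0 ?wt_ge0. Qed.

Lemma sum_if_lt (U : nmodType) N M (F : nat -> U) : (N <= M)%N ->
  \sum_(i < M) (if (i < N)%N then F i else 0) = \sum_(i < N) F i.
Proof. by move=> NM; rewrite -big_mkcond /= (big_ord_widen _ F NM). Qed.

Lemma sum2_if_lt (U : nmodType) N M (F : nat -> nat -> U) : (N <= M)%N ->
  \sum_(i < M) \sum_(j < M) (if (i < N)%N && (j < N)%N then F i j else 0) =
  \sum_(i < N) \sum_(j < N) F i j.
Proof.
move=> NM; rewrite -(sum_if_lt _ _ _ (fun i => \sum_(j < N) F i j) NM).
apply: eq_bigr => i _; case: ifP => iN /=; last by rewrite big1.
exact: sum_if_lt.
Qed.

Lemma partial_sum_mono rho (c : coefs R) N M : 0 < rho -> (N <= M)%N ->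
  partial_sum rho c N <= partial_sum rho c M.
Proof.
move=> r0 NM; rewrite /partial_sum.
rewrite -(sum2_if_lt _ _ _ (fun i j => absC (c i j) * wt rho i j) NM).
apply: ler_sum => i _; apply: ler_sum => j _.
by case: ifP => // _; apply: term_ge0.
Qed.

Lemma partial_sum_le_nrm rho a N : 0 < rho -> partial_sum rho (aval a) N <= nrm rho a.
Proof.
move=> r0; apply: ub_le_sup; last by exists N.
have /asboolP/(_ rho r0)[M hM] := avalP a.
by exists M => _ [n _ <-].
Qed.

Lemma nrm_le rho a (C : R) : (forall N, partial_sum rho (aval a) N <= C) -> nrm rho a <= C.
Proof.
move=> h; apply: ge_sup; first by exists (partial_sum rho (aval a) 0), 0%N.
by move=> _ [n _ <-].
Qed.

Lemma partial_sum_ge0 rho (c : coefs R) N : 0 < rho -> 0 <= partial_sum rho c N.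
Proof. by move=> r0; apply: sumr_ge0 => i _; apply: sumr_ge0 => j _; apply: term_ge0. Qed.

Lemma nrm_ge0 rho a : 0 < rho -> 0 <= nrm rho a.
Proof.
move=> r0; apply: le_trans (partial_sum_le_nrm _ _ 0%N r0); exact: partial_sum_ge0.
Qed.

Lemma partial_sumD rho (c d : coefs R) N : 0 < rho ->
  partial_sum rho (c + d) N <= partial_sum rho c N + partial_sum rho d N.
Proof.
move=> r0; rewrite /partial_sum -big_split; apply: ler_sum => i _.
rewrite -big_split; apply: ler_sum => j _ /=.
rewrite -mulrDl ler_wpM2r ?wt_ge0 //; exact: absC_add.
Qed.

Lemma seminorm_nrm rho : 0 < rho -> seminorm (nrm rho).
Proof.
move=> r0; apply: seminormP => [a|a b|k a]; first exact: nrm_ge0.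
  apply: nrm_le => N; apply: le_trans (partial_sumD _ _ _ _ r0) _.
  by rewrite lerD // partial_sum_le_nrm.
apply: nrm_le => N.
apply: (@le_trans _ _ (absC k * partial_sum rho (aval a) N)); last first.
  by rewrite ler_wpM2l ?absC_ge0 ?partial_sum_le_nrm.
rewrite /partial_sum mulr_sumr; apply: ler_sum => i _.
rewrite mulr_sumr; apply: ler_sum => j _.
by rewrite mulrA ler_wpM2r ?wt_ge0 // -absC_mul.
Qed.

Lemma acoef_le_nrm rho a i j : 0 < rho -> absC (acoef i j a) * wt rho i j <= nrm rho a.
Proof.
move=> r0; pose N := (maxn i j).+1.
have iN : (i < N)%N by rewrite ltnS leq_maxl.
have jN : (j < N)%N by rewrite ltnS leq_maxr.
apply: le_trans (partial_sum_le_nrm _ _ N r0); rewrite /partial_sum.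
rewrite (bigD1 (Ordinal iN)) //= (bigD1 (Ordinal jN)) //= -addrA lerDl addr_ge0 //.
  by apply: sumr_ge0 => l _; apply: term_ge0.
by apply: sumr_ge0 => k _; apply: sumr_ge0 => l _; apply: term_ge0.
Qed.

(** All weights are positive, so a single norm already separates points. *)
Lemma nrm_eq0 a : nrm 1 a = 0 -> a = 0.
Proof.
move=> a0; apply: Aspace_ext => i j; apply: absC_eq0; apply/le_anti.
rewrite absC_ge0 andbT -(pmulr_lle0 _ (wt_gt0 1 i j ltr01)) -a0.
exact: acoef_le_nrm.
Qed.

Lemma sum2_delta (U : nmodType) N i j (F : nat -> nat -> U) :
  \sum_(k < N) \sum_(l < N) (if ((k : nat) == i) && ((l : nat) == j) then F k l else 0)
  = if (i < N)%N && (j < N)%N then F i j else 0.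
Proof.
rewrite (eq_bigr (fun k : 'I_N => if (k : nat) == i then
    (if (j < N)%N then F k j else 0) else 0)); last first.
  move=> k _; case: eqP => _ /=; last by rewrite big1.
  by rewrite -big_mkcond /= (big_ord1_eq _ (fun l => F k l)).
rewrite -big_mkcond /= (big_ord1_eq _ (fun k => if (j < N)%N then F k j else 0)).
by case: (i < N)%N.
Qed.

Lemma partial_sum_delta rho i j N : 0 < rho -> partial_sum rho (delta R i j) N <= wt rho i j.
Proof.
move=> r0; rewrite /partial_sum (eq_bigr (fun k : 'I_N => \sum_(l < N)
   (if ((k : nat) == i) && ((l : nat) == j) then wt rho k l else 0))).
  by rewrite (sum2_delta _ _ _ _ (wt rho)); case: ifP => // _; apply: wt_ge0.
move=> k _; apply: eq_bigr => l _; rewrite /delta.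
by case: ifP => _; rewrite ?absC1 ?mul1r ?absC0 ?mul0r.
Qed.

Lemma inAb_delta i j : inAb (delta R i j).
Proof. by apply/asboolP => rho r0; exists (wt rho i j) => N; apply: partial_sum_delta. Qed.

Definition mono (i j : nat) : Aspace R := ASub (inAb_delta i j).

Lemma acoef_mono i j k l : acoef k l (mono i j) = ((k == i) && (l == j))%:R.
Proof. by rewrite /acoef /= /delta; case: ifP. Qed.

Lemma nrm_mono_le rho i j : 0 < rho -> nrm rho (mono i j) <= wt rho i j.
Proof. by move=> r0; apply: nrm_le => N; apply: partial_sum_delta. Qed.

(** The value on the truncation of [a] to the square [i, j < N] of the linear map sending [x^i y^j]
    to [v i j]; for [v = mono] it is the truncation itself. *)
Definition fsum {V : lmodType R[i]} (v : nat -> nat -> V) (N : nat) (a : Aspace R) : V :=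
  \sum_(i < N) \sum_(j < N) acoef i j a *: v i j.

Definition trunc := fsum mono.

Section Fsum.
Context {V : lmodType R[i]} (v : nat -> nat -> V).

Lemma fsum_linear N (k : R[i]) a b : fsum v N (k *: a + b) = k *: fsum v N a + fsum v N b.
Proof.
rewrite /fsum scaler_sumr -big_split; apply: eq_bigr => i _.
rewrite scaler_sumr -big_split; apply: eq_bigr => j _ /=.
by rewrite acoefD acoefZ scalerDl scalerA.
Qed.

Lemma fsumB N a b : fsum v N (a - b) = fsum v N a - fsum v N b.
Proof. by have := fsum_linear N (-1) b a; rewrite !scaleN1r addrC => ->; rewrite addrC. Qed.

Lemma fsum_mono N i j : fsum v N (mono i j) = if (i < N)%N && (j < N)%N then v i j else 0.
Proof.
rewrite -(sum2_delta _ _ _ _ v) /fsum; apply: eq_bigr => k _; apply: eq_bigr => l _.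
by rewrite acoef_mono; case: ifP => _; rewrite ?scale1r ?scale0r.
Qed.

Lemma fsum_le (p : V -> R) C rho : seminorm p -> 0 < rho ->
  (forall i j, p (v i j) <= C * wt rho i j) ->
  forall N a, p (fsum v N a) <= C * partial_sum rho (aval a) N.
Proof.
move=> sp r0 h N a; apply: le_trans (seminorm_sum sp _ _ _ _) _.
rewrite mulr_sumr; apply: ler_sum => i _.
apply: le_trans (seminorm_sum sp _ _ _ _) _; rewrite mulr_sumr; apply: ler_sum => j _.
by rewrite (seminormZ sp) mulrCA ler_wpM2l ?absC_ge0.
Qed.

End Fsum.

Lemma acoef_trunc i j N a : acoef i j (trunc N a) = if (i < N)%N && (j < N)%N then acoef i j a else 0.
Proof.
rewrite /trunc /fsum acoef_sum.
under eq_bigr do rewrite acoef_sum.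
rewrite -(sum2_delta _ _ _ _ (fun k l => acoef k l a)).
apply: eq_bigr => k _; apply: eq_bigr => l _; rewrite acoefZ acoef_mono eq_sym [_ == (l : nat)]eq_sym.
by case: ifP => _; rewrite ?mulr1 ?mulr0.
Qed.

Lemma fsum_trunc {V : lmodType R[i]} (v : nat -> nat -> V) N M a : (N <= M)%N ->
  fsum v M (trunc N a) = fsum v N a.
Proof.
move=> NM; rewrite /fsum -(sum2_if_lt _ _ _ (fun i j => acoef i j a *: v i j) NM).
apply: eq_bigr => i _; apply: eq_bigr => j _; rewrite acoef_trunc.
by case: ifP; rewrite ?scale0r.
Qed.

(** The coefficients of [a - trunc N a] vanish inside the square of side [N] and equal those of [a]
    outside it. *)
Lemma partial_sum_tail rho a N M : (N <= M)%N ->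
  partial_sum rho (aval (a - trunc N a)) M =
  partial_sum rho (aval a) M - partial_sum rho (aval a) N.
Proof.
move=> NM; apply/eqP; rewrite eq_sym subr_eq eq_sym; apply/eqP; rewrite /partial_sum.
rewrite -(sum2_if_lt _ _ _ (fun i j => absC (acoef i j a) * wt rho i j) NM) -big_split.
apply: eq_bigr => i _; rewrite -big_split; apply: eq_bigr => j _.
rewrite -[aval (a - _) _ _]/(acoef i j (a - trunc N a)) acoefB acoef_trunc.
by case: ifP => _ /=; [rewrite subrr absC0 mul0r add0r|rewrite subr0 addr0].
Qed.

Lemma trunc_cvg rho a e : 0 < rho -> 0 < e ->
  exists N0, forall N, (N0 <= N)%N -> nrm rho (a - trunc N a) <= e.
Proof.
move=> r0 e0.
have hs : has_sup (range (partial_sum rho (aval a))).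
  split; first by exists (partial_sum rho (aval a) 0), 0%N.
  by exists (nrm rho a) => _ [n _ <-]; apply: partial_sum_le_nrm.
(* Some partial sum comes within [e] of the supremum; what is left for the tail beyond it is at most
   [e]. *)
have [_ [N0 _ <-] h] := sup_adherent e0 hs.
exists N0 => N hN; apply: nrm_le => M.
apply: (@le_trans _ _ (partial_sum rho (aval (a - trunc N a)) (maxn M N))).
  by apply: partial_sum_mono; rewrite ?leq_maxl.
rewrite partial_sum_tail ?leq_maxr //.
have := partial_sum_le_nrm _ a (maxn M N) r0.
have := partial_sum_mono _ (aval a) _ _ r0 hN.
by move: h; rewrite -/(normA rho (aval a)) -/(nrm rho a); lra.
Qed.

End CoefficientSpace.

(** * Completeness and extension from monomials *)

Section Completeness.
Variable R : realType.

Lemma partial_sum_distC rho (c d : coefs R) N :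
  partial_sum rho (c - d) N = partial_sum rho (d - c) N.
Proof.
rewrite /partial_sum; apply: eq_bigr => i _; apply: eq_bigr => j _; congr (_ * _).
rewrite -[LHS]absCN; congr absC; exact: opprB.
Qed.

Lemma seminorm_normAs (rho : posR R) : seminorm (normAs rho).
Proof. exact: seminorm_nrm (svalP rho). Qed.

Lemma normAs_hausdorff : sn_hausdorff (@normAs R).
Proof. by move=> a h; apply: nrm_eq0; apply: (h (exist _ 1 ltr01)). Qed.

Lemma filter_sum_small {V : lmodType R[i]} {F : (V -> Prop) -> Prop} (G : nat -> V -> R) N :
  is_filter F -> (forall k e, 0 < e -> F (fun a => G k a < e)) ->
  forall e, 0 < e -> F (fun a => \sum_(k < N) G k a < e).
Proof.
move=> [FT FI Fsub] h; elim: N => [|N IH] e e0.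
  by apply: Fsub FT => a _; rewrite big_ord0.
have e20 : 0 < e / 2 by lra.
apply: Fsub (FI _ _ (IH _ e20) (h N _ e20)) => a [h1 h2].
by rewrite big_ord_recr /=; lra.
Qed.

(** As for weighted l^1 spaces: take coefficientwise limits, then pass the Cauchy estimate to the
    limit on each finite square, uniformly in its size. *)
Lemma normAs_complete : sn_complete (@normAs R).
Proof.
move=> F fF cF; have [FT FI Fsub] := fF.
(* [is_filter] admits the improper filter, which converges to every point. *)
have [nF|nF] := pselect (F (fun=> False)).
  by exists 0 => U _ _; apply: Fsub nF.
(* Each coefficient is bounded by a multiple of the norm of radius 1, so it is Cauchy along [F]. *)
have [c hc] : exists c : coefs R, forall i j e, 0 < e ->
    F (fun a => absC (acoef R i j a - c i j) < e).
  have /choice [c hc] : forall ij : nat * nat, exists L, forall e, 0 < e ->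
      F (fun a => absC (acoef R ij.1 ij.2 a - L) < e).
    move=> [i j] /=; apply: (filter_complex_limit fF nF) => e e0.
    have w0 : 0 < wt 1 i j :> R := wt_gt0 _ _ _ _ ltr01.
    have [S [FS hS]] := cF (exist _ 1 ltr01) (e * wt 1 i j) (mulr_gt0 e0 w0).
    exists S; split=> // a b Sa Sb; rewrite -(ltr_pM2r w0).
    apply: le_lt_trans (hS _ _ Sa Sb); rewrite -acoefB.
    exact: (acoef_le_nrm _ 1 (a - b)).
  by exists (fun i j => c (i, j)) => i j e /(hc (i, j)).
have small rho N e : 0 < rho -> 0 < e -> F (fun a => partial_sum rho (aval a - c) N < e).
  move=> r0; move: e; apply: (filter_sum_small
    (fun i a => \sum_(j < N) absC ((aval a - c) i j) * wt rho i j)) => // i.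
  apply: (filter_sum_small (fun j a => absC ((aval a - c) i j) * wt rho i j)) => // j e e0.
  have w0 := wt_gt0 _ rho i j r0.
  by apply: Fsub (hc i j _ (divr_gt0 e0 w0)) => a; rewrite ltr_pdivlMr.
(* The Cauchy set [S] is fixed before [N]; only the auxiliary [b] in [S], close to [c] on the square
   of side [N], depends on [N]. Hence the bound is uniform in [N]. *)
have close rho e : 0 < rho -> 0 < e ->
    F (fun a => forall N, partial_sum rho (aval a - c) N <= e).
  move=> r0 e0; have e20 : 0 < e / 2 by lra.
  have [S [FS hS]] := cF (exist _ rho r0) _ e20.
  have FS0 := FS; apply: Fsub FS => a Sa N.
  have [b [Sb hb]] := filter_ex fF nF _ (FI _ _ FS0 (small rho N _ r0 e20)).
  have -> : aval a - c = aval (a - b) + (aval b - c) by rewrite addrA subrK.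
  apply: le_trans (partial_sumD _ _ _ _ _ r0) _.
  have := partial_sum_le_nrm _ _ (a - b) N r0.
  have : nrm R rho (a - b) < e / 2 := hS _ _ Sa Sb; lra.
have Ac : inAb c.
  apply/asboolP => rho r0.
  have [a ha] := filter_ex fF nF _ (close rho 1 r0 ltr01).
  exists (nrm _ rho a + 1) => N.
  have -> : c = aval a + (c - aval a) by rewrite addrC subrK.
  apply: le_trans (partial_sumD _ _ _ _ _ r0) _.
  by rewrite lerD ?partial_sum_le_nrm // partial_sum_distC.
exists (ASub Ac); apply: (ball_sn_converges fF) => [[rho r0]] e e0.
have e20 : 0 < e / 2 by lra.
apply: Fsub (close rho _ r0 e20) => a ha.
apply: (@le_lt_trans _ _ (e / 2)); last lra.
exact: nrm_le.
Qed.

End Completeness.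

Section Extension.
Context {R : realType} {V : lmodType R[i]} {I : Type} {p : I -> V -> R}.
Hypotheses (sp : forall i, seminorm (p i)) (hp : sn_hausdorff p).

(** Truncations are finite combinations of monomials and converge to [a] in every norm, so [f] and
    [g] agree at [a] by continuity. *)
Lemma dense_mono_eq (f g : {linear Aspace R -> V}) :
  sn_continuous (@normAs R) p f -> sn_continuous (@normAs R) p g ->
  (forall i j, f (mono R i j) = g (mono R i j)) -> f =1 g.
Proof.
move=> cf cg fg a; apply/eqP; rewrite -subr_eq0; apply/eqP.
apply: (sn_eq0 sp hp) => i e e0; have e20 : 0 < e / 2 by lra.
have [s [d [d0 hf]]] := sn_continuous_at0 sp cf (raddf0 f) i _ e20.
have [t [c [c0 hg]]] := sn_continuous_at0 sp cg (raddf0 g) i _ e20.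
(* One truncation must be close in all the norms that control [f] and [g]. Aiming at half the
   minimum turns the weak inequality of [trunc_cvg] into a strict one. *)
have [N hN] : exists N, forall rho, List.In rho (s ++ t) ->
    normAs rho (a - trunc R N a) < Num.min d c.
  have m0 : 0 < Num.min d c / 2 by rewrite divr_gt0 // lt_min d0.
  suff [N0 h] : exists N0, forall N, (N0 <= N)%N -> forall rho, List.In rho (s ++ t) ->
      normAs rho (a - trunc R N a) <= Num.min d c / 2.
    by exists N0 => rho /(h _ (leqnn _)); lra.
  elim: (s ++ t) => [|rho u [N0 IH]]; first by exists 0%N.
  have [N1 h1] := trunc_cvg _ (sval rho) a _ (svalP rho) m0.
  exists (maxn N0 N1) => N; rewrite geq_max => /andP[l0 l1] sigma /= [<-|].
    exact: h1.
  exact: IH.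
have h1 : p i (f (a - trunc R N a)) < e / 2.
  apply: hf => rho hr; have := hN rho; rewrite lt_min => /(_ _)/andP[] //.
  by apply/List.in_app_iff; left.
have h2 : p i (g (a - trunc R N a)) < e / 2.
  apply: hg => rho hr; have := hN rho; rewrite lt_min => /(_ _)/andP[] //.
  by apply/List.in_app_iff; right.
have e1 : f (a - trunc R N a) = f a - f (trunc R N a) := raddfB f _ _.
have e2 : g (a - trunc R N a) = g a - g (trunc R N a) := raddfB g _ _.
have e3 : f (trunc R N a) = g (trunc R N a).
  rewrite /trunc /fsum !raddf_sum; apply: eq_bigr => k _.
  by rewrite !raddf_sum; apply: eq_bigr => l _; rewrite /= !linearZ /= fg.
have -> : f a - g a = f (a - trunc R N a) - g (a - trunc R N a).
  by rewrite e1 e2 e3 opprB addrA subrK.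
by apply: le_lt_trans (seminormB (sp i) _ _) _; lra.
Qed.

Hypothesis cp : sn_complete p.

(** The value at [a] is the limit of [fsum v N a], which is Cauchy because [v] grows no faster than
    the weights; linearity and the bounds pass to the limit. *)
Lemma extension_exists (v : nat -> nat -> V) :
  (forall i, exists C rho, 0 < rho /\ forall k l, p i (v k l) <= C * wt rho k l) ->
  exists f : {linear Aspace R -> V},
    (forall i j, f (mono R i j) = v i j) /\
    forall i C rho, 0 < rho -> (forall k l, p i (v k l) <= C * wt rho k l) ->
      forall a, p i (f a) <= C * nrm R rho a.
Proof.
move=> hv.
(* At [k = l = 0] the weight is 1, so [C] dominates a seminorm value. *)
have C_ge0 i C rho : (forall k l, p i (v k l) <= C * wt rho k l) -> 0 <= C.
  move/(_ 0%N 0%N); rewrite /wt expr0 fact0 divr1 mulr1.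
  by apply: le_trans; apply: seminorm_ge0.
have /choice [f hf] : forall a, exists l, forall i e, 0 < e -> exists N0, forall N,
    (N0 <= N)%N -> p i (fsum R v N a - l) < e.
  move=> a.
  (* Completeness is stated with filters; this is the filter of sets that eventually contain the
     sequence. *)
  pose F (S : V -> Prop) := exists N0, forall N, (N0 <= N)%N -> S (fsum R v N a).
  have fF : is_filter F.
    split; first by exists 0%N.
      move=> S T [N1 h1] [N2 h2]; exists (maxn N1 N2) => N.
      by rewrite geq_max => /andP[? ?]; split; [apply: h1|apply: h2].
    by move=> S T ST [N0 h]; exists N0 => N /h /ST.
  have [|l hl] := cp F fF; last by exists l => i e e0; exact: (sn_converges_ball sp hl i e e0).
  move=> i e e0; have [C [rho [r0 hC]]] := hv i.
  have C1 : 0 < `|C| + 1 by rewrite ltr_wpDl.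
  (* This radius puts all later terms within [e / 4] of the term of index [N0], hence within [e / 2]
     of one another. *)
  have d0 : 0 < e / 2 / 2 / (`|C| + 1) by rewrite divr_gt0 //; lra.
  have [N0 hN] := trunc_cvg _ rho a _ r0 d0.
  have near M : (N0 <= M)%N -> p i (fsum R v M a - fsum R v N0 a) <= e / 2 / 2.
    move=> NM; rewrite -(fsum_trunc _ v _ _ a NM) -fsumB.
    apply: le_trans (fsum_le _ _ _ _ _ (sp i) r0 hC _ _) _.
    have := hN _ (leqnn _); rewrite ler_pdivlMr // => h; apply: le_trans h.
    apply: (@le_trans _ _ (C * nrm R rho (a - trunc R N0 a))).
      by rewrite ler_wpM2l ?partial_sum_le_nrm // (C_ge0 i C rho).
    by rewrite mulrC ler_wpM2l ?nrm_ge0 // (le_trans (ler_norm _)) // lerDl.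
  exists (fun b => p i (b - fsum R v N0 a) <= e / 2 / 2); split; first by exists N0.
  move=> b b' hb hb'.
  have -> : b - b' = (b - fsum R v N0 a) - (b' - fsum R v N0 a) by rewrite opprB addrA subrK.
  by apply: le_lt_trans (seminormB (sp i) _ _) _; lra.
have flin : linear f.
  move=> k a b; apply/eqP; rewrite -subr_eq0; apply/eqP.
  apply: (sn_eq0 sp hp) => i e e0.
  have k1 : 0 < absC k + 1 by rewrite ltr_wpDl ?absC_ge0.
  have e30 : 0 < e / 3 by lra.
  have [N1 h1] := hf (k *: a + b) i _ e30.
  have [N2 h2] := hf a i _ (divr_gt0 e30 k1).
  have [N3 h3] := hf b i _ e30.
  pose N := maxn N1 (maxn N2 N3).
  have {}h1 := h1 N (leq_maxl _ _).
  have {}h2 := h2 N (leq_trans (leq_maxl _ _) (leq_maxr _ _)).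
  have {}h3 := h3 N (leq_trans (leq_maxr _ _) (leq_maxr _ _)).
  have -> : f (k *: a + b) - (k *: f a + f b) =
     k *: (fsum R v N a - f a) + (fsum R v N b - f b) - (fsum R v N (k *: a + b) - f (k *: a + b)).
    rewrite fsum_linear scalerBr; move: (k *: fsum _ _ _ _) (k *: f a) => x y.
    move: (fsum _ _ _ _) (f b) (f _) => z w u.
    by rewrite addrACA -opprD opprB [RHS]addrC addrA subrK.
  apply: le_lt_trans (seminormB (sp i) _ _) _.
  have := seminormD (sp i) (k *: (fsum R v N a - f a)) (fsum R v N b - f b).
  rewrite (seminormZ (sp i)).
  have : absC k * p i (fsum R v N a - f a) <= e / 3.
    rewrite ltr_pdivlMr // in h2; apply: le_trans (ltW h2).
    by rewrite mulrC ler_wpM2l ?seminorm_ge0 // lerDl.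
  lra.
pose fl : {linear Aspace R -> V} := HB.pack f (GRing.isLinear.Build _ _ _ _ f flin).
exists fl; split=> [i j|i C rho r0 hC a] /=.
  apply/eqP; rewrite -subr_eq0; apply/eqP; apply: (sn_eq0 sp hp) => k e e0.
  have [N hN] := hf (mono R i j) k e e0; rewrite (seminormC (sp k)).
  have := hN (maxn N (maxn i j).+1) (leq_maxl _ _).
  by rewrite fsum_mono !leq_max !ltnS leq_maxl leq_maxr !orbT.
apply/ler_addgt0Pr => e e0; have [N hN] := hf a i e e0.
have := hN N (leqnn _); rewrite (seminormC (sp i)) => h.
have := seminormD (sp i) (f a - fsum R v N a) (fsum R v N a); rewrite subrK => h2.
have h3 := fsum_le _ _ _ _ _ (sp i) r0 hC N a.
have h4 : C * partial_sum rho (aval a) N <= C * nrm R rho a.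
  by rewrite ler_wpM2l ?partial_sum_le_nrm // (C_ge0 i C rho).
lra.
Qed.

End Extension.

(** * The multiplication *)

Section Multiplication.
Variable R : realType.
Implicit Types (a b c : Aspace R) (rho : R).

Lemma linear_cont {W : lmodType R[i]} {J : Type} {q : J -> W -> R} (f : {linear Aspace R -> W}) :
  (forall j, exists rho C, 0 < rho /\ forall a, q j (f a) <= C * nrm R rho a) ->
  sn_continuous (@normAs R) q f.
Proof.
move=> h; apply: bounded_sn_continuous => [a b|j|rho a]; first exact: raddfB.
  have [rho [C [r0 hC]]] := h j; by exists (exist _ rho r0), C.
exact: seminorm_ge0 (seminorm_normAs R rho) a.
Qed.

(** The map [s] allows the radius to grow: multiplication needs [2 * rho], while right
    multiplication by [x] or [y^l] keeps [rho]. *)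
Lemma Aspace_extension (v : nat -> nat -> Aspace R) (C s : R -> R) :
  (forall rho, 0 < rho -> 0 < s rho) ->
  (forall rho k l, 0 < rho -> nrm R rho (v k l) <= C rho * wt (s rho) k l) ->
  exists f : {linear Aspace R -> Aspace R}, (forall i j, f (mono R i j) = v i j) /\
    forall rho a, 0 < rho -> nrm R rho (f a) <= C rho * nrm R (s rho) a.
Proof.
move=> s0 hv.
have [|f [fm fb]] := extension_exists (seminorm_normAs R) (@normAs_hausdorff R)
    (@normAs_complete R) v.
  by move=> [rho r0]; exists (C rho), (s rho); split=> [|k l]; [exact: s0|exact: hv].
exists f; split=> // rho a r0; apply: (fb (exist _ rho r0)) => [|k l]; first exact: s0.
exact: hv.
Qed.

(** Amounts to [j! l! <= (j + l)!], since the binomial coefficient is at least 1. *)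
Lemma wt_addr rho i j l : 0 < rho -> wt rho i (j + l) <= rho ^+ l / l`!%:R * wt rho i j.
Proof.
move=> r0; rewrite /wt.
have -> : rho ^+ l / l`!%:R * (rho ^+ (i + j) / j`!%:R) =
    rho ^+ (i + (j + l)) / (j`! * l`!)%:R.
  by rewrite addnA [in RHS]exprD natrM invfM; ring.
rewrite ler_wpM2l ?(exprn_ge0 _ (ltW r0)) //.
rewrite lef_pV2 ?posrE ?ltr0n ?muln_gt0 ?fact_gt0 // ler_nat.
by rewrite -(bin_fact (leq_addr l j)) addKn leq_pmull // bin_gt0 leq_addr.
Qed.

Lemma mulYr_exists l : exists f : {linear Aspace R -> Aspace R},
  (forall i j, f (mono R i j) = mono R i (j + l)) /\
  forall rho a, 0 < rho -> nrm R rho (f a) <= rho ^+ l / l`!%:R * nrm R rho a.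
Proof.
apply: (Aspace_extension _ (fun rho => rho ^+ l / l`!%:R) id) => // rho i j r0.
by apply: le_trans (nrm_mono_le _ _ _ _ r0) _; exact: wt_addr.
Qed.

Lemma mulXr_exists : exists f : {linear Aspace R -> Aspace R},
  (forall i j, f (mono R i j) = mono R i.+1 j + j%:R *: mono R i j.+1) /\
  forall rho a, 0 < rho -> nrm R rho (f a) <= 2 * rho * nrm R rho a.
Proof.
apply: (Aspace_extension _ (fun rho => 2 * rho) id) => // rho i j r0.
apply: le_trans (seminormD (seminorm_nrm _ _ r0) _ _) _.
rewrite (seminormZ (seminorm_nrm _ _ r0)) absC_nat.
have h1 : nrm R rho (mono R i.+1 j) <= rho * wt rho i j.
  by apply: le_trans (nrm_mono_le _ _ _ _ r0) _; rewrite /wt addSn exprS mulrA.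
(* The factor [j] is absorbed by the factorial: [j / (j+1)! <= 1 / j!]. *)
have h2 : j%:R * nrm R rho (mono R i j.+1) <= rho * wt rho i j.
  apply: (@le_trans _ _ (j%:R * wt rho i j.+1)).
    by rewrite ler_wpM2l ?ler0n // nrm_mono_le.
  have wE : wt rho i j = j.+1%:R * (rho ^+ (i + j) / (j.+1)`!%:R).
    by rewrite /wt factS natrM invfM mulrCA mulVKf // pnatr_eq0.
  rewrite wE [leRHS]mulrCA /wt addnS exprS -[rho * _ / _]mulrA.
  by rewrite ler_wpM2r ?ler_nat // mulr_ge0 ?divr_ge0 ?exprn_ge0 ?(ltW r0).
lra.
Qed.

Definition mulYr l : {linear Aspace R -> Aspace R} := sval (cid (mulYr_exists l)).

Definition mulXr : {linear Aspace R -> Aspace R} := sval (cid mulXr_exists).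

Lemma mulYr_mono l i j : mulYr l (mono R i j) = mono R i (j + l).
Proof. by have [h _] := svalP (cid (mulYr_exists l)); apply: h. Qed.

Lemma mulXr_mono i j : mulXr (mono R i j) = mono R i.+1 j + j%:R *: mono R i j.+1.
Proof. by have [h _] := svalP (cid mulXr_exists); apply: h. Qed.

Lemma nrm_mulYr l rho a : 0 < rho -> nrm R rho (mulYr l a) <= rho ^+ l / l`!%:R * nrm R rho a.
Proof. by have [_ h] := svalP (cid (mulYr_exists l)); apply: h. Qed.

Lemma nrm_mulXr rho a : 0 < rho -> nrm R rho (mulXr a) <= 2 * rho * nrm R rho a.
Proof. by have [_ h] := svalP (cid mulXr_exists); apply: h. Qed.

Lemma nrm_iter_mulXr k rho a : 0 < rho ->
  nrm R rho (iter k mulXr a) <= (2 * rho) ^+ k * nrm R rho a.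
Proof.
move=> r0; elim: k => [|k IH]; first by rewrite mul1r.
apply: le_trans (nrm_mulXr _ _ r0) _.
by rewrite exprS -[leRHS]mulrA ler_wpM2l // mulr_ge0 ?(ltW r0).
Qed.

Lemma mulYr_cont l : sn_continuous (@normAs R) (@normAs R) (mulYr l).
Proof.
apply: linear_cont => [[rho r0]]; exists rho, (rho ^+ l / l`!%:R); split=> // a.
exact: nrm_mulYr.
Qed.

Lemma mulXr_cont : sn_continuous (@normAs R) (@normAs R) mulXr.
Proof.
apply: linear_cont => [[rho r0]]; exists rho, (2 * rho); split=> // a.
exact: nrm_mulXr.
Qed.

Lemma Aspace_dense (f g : {linear Aspace R -> Aspace R}) :
  sn_continuous (@normAs R) (@normAs R) f -> sn_continuous (@normAs R) (@normAs R) g ->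
  (forall i j, f (mono R i j) = g (mono R i j)) -> f =1 g.
Proof. exact: (dense_mono_eq (seminorm_normAs R) (@normAs_hausdorff R)). Qed.

Lemma mulYrD l m a : mulYr l (mulYr m a) = mulYr (m + l) a.
Proof.
apply: (Aspace_dense (mulYr l \o mulYr m)) => [||i j /=]; last by rewrite !mulYr_mono addnA.
  exact: sn_continuous_comp (mulYr_cont l) (mulYr_cont m).
exact: mulYr_cont.
Qed.

Lemma mulYr0 a : mulYr 0 a = a.
Proof.
apply: (Aspace_dense (mulYr 0) idfun) => [||i j]; [exact: mulYr_cont|by []|].
by rewrite mulYr_mono addn0.
Qed.

(** The identity [y^l x = x y^l + l y^(l+1)], read through right multiplications. *)
Lemma mulXYr l a : mulXr (mulYr l a) = mulYr l (mulXr a) + l%:R *: mulYr l.+1 a.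
Proof.
apply: (Aspace_dense (mulXr \o mulYr l)
  ((mulYr l \o mulXr) \+ (l%:R \*: mulYr l.+1))) => [||i j].
- exact: sn_continuous_comp mulXr_cont (mulYr_cont l).
- apply: sn_continuousD; [exact: seminorm_normAs| |apply: sn_continuousZ].
  + exact: sn_continuous_comp (mulYr_cont l) mulXr_cont.
  + exact: seminorm_normAs.
  + exact: mulYr_cont.
rewrite /= mulYr_mono !mulXr_mono linearD linearZ /= !mulYr_mono.
by rewrite -addrA addnS addSn -scalerDl natrD.
Qed.

(** The product of [a] with [x^k y^l] is obtained by multiplying on the right by [x] [k] times, then
    by [y^l]. The factor [(2 rho)^k] from the [x] steps is why the second radius is [2 * rho]. *)
Lemma mul_exists a : exists f : {linear Aspace R -> Aspace R},
  (forall k l, f (mono R k l) = mulYr l (iter k mulXr a)) /\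
  forall rho b, 0 < rho -> nrm R rho (f b) <= nrm R rho a * nrm R (2 * rho) b.
Proof.
apply: (Aspace_extension _ (fun rho => nrm R rho a) ( *%R 2)) => [rho r0|rho k l r0].
  by rewrite mulr_gt0.
apply: le_trans (nrm_mulYr _ _ _ r0) _.
have c0 : 0 <= rho ^+ l / l`!%:R :> R by rewrite divr_ge0 ?exprn_ge0 ?(ltW r0).
apply: le_trans (ler_wpM2l c0 (nrm_iter_mulXr k _ a r0)) _.
rewrite mulrA mulrC ler_wpM2l ?nrm_ge0 // /wt exprD mulrC -mulrA.
rewrite ler_wpM2l ?exprn_ge0 ?mulr_ge0 ?(ltW r0) //.
rewrite ler_wpM2r ?invr_ge0 //.
by rewrite lerXn2r ?nnegrE ?mulr_ge0 ?(ltW r0) //; lra.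
Qed.

Definition amul a : {linear Aspace R -> Aspace R} := sval (cid (mul_exists a)).

Lemma amul_mono a k l : amul a (mono R k l) = mulYr l (iter k mulXr a).
Proof. by have [h _] := svalP (cid (mul_exists a)); apply: h. Qed.

Lemma nrm_amul rho a b : 0 < rho -> nrm R rho (amul a b) <= nrm R rho a * nrm R (2 * rho) b.
Proof. by have [_ h] := svalP (cid (mul_exists a)); apply: h. Qed.

Lemma amul_cont a : sn_continuous (@normAs R) (@normAs R) (amul a).
Proof.
apply: linear_cont => [[rho r0]]; exists (2 * rho), (nrm R rho a).
by split=> [|b]; [rewrite mulr_gt0|exact: nrm_amul].
Qed.

Lemma iter_mulXr_linear m (k : R[i]) a b :
  iter m mulXr (k *: a + b) = k *: iter m mulXr a + iter m mulXr b.
Proof. by elim: m => //= m ->; rewrite linearP. Qed.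

Lemma amul_linearl (k : R[i]) a b c : amul (k *: a + b) c = k *: amul a c + amul b c.
Proof.
apply: (Aspace_dense (amul (k *: a + b)) ((k \*: amul a) \+ amul b)) => [||i j].
- exact: amul_cont.
- apply: sn_continuousD; [exact: seminorm_normAs|apply: sn_continuousZ|exact: amul_cont].
  + exact: seminorm_normAs.
  + exact: amul_cont.
by rewrite /= !amul_mono iter_mulXr_linear linearP.
Qed.

Lemma amul_mulYr l a b : amul a (mulYr l b) = mulYr l (amul a b).
Proof.
apply: (Aspace_dense (amul a \o mulYr l) (mulYr l \o amul a)) => [||i j].
- exact: sn_continuous_comp (amul_cont a) (mulYr_cont l).
- exact: sn_continuous_comp (mulYr_cont l) (amul_cont a).
by rewrite /= mulYr_mono !amul_mono mulYrD.
Qed.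

(** Associativity with last factor [x]; on monomials it reduces to the commutation rule [mulXYr].
    With [amul_mulYr] it gives full associativity by density in the last factor. *)
Lemma amul_mulXr a b : amul a (mulXr b) = mulXr (amul a b).
Proof.
apply: (Aspace_dense (amul a \o mulXr) (mulXr \o amul a)) => [||i j].
- exact: sn_continuous_comp (amul_cont a) mulXr_cont.
- exact: sn_continuous_comp mulXr_cont (amul_cont a).
by rewrite /= mulXr_mono linearD linearZ /= !amul_mono mulXYr.
Qed.

Lemma amulA a b c : amul a (amul b c) = amul (amul a b) c.
Proof.
apply: (Aspace_dense (amul a \o amul b) (amul (amul a b))) => [||i j].
- exact: sn_continuous_comp (amul_cont a) (amul_cont b).
- exact: amul_cont.
rewrite /= !amul_mono amul_mulYr; congr (mulYr _ _).
by elim: i => //= i IH; rewrite amul_mulXr IH.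
Qed.

Lemma iter_mulXr_mono k i : iter k mulXr (mono R i 0) = mono R (k + i) 0.
Proof. by elim: k => //= k ->; rewrite mulXr_mono scale0r addr0. Qed.

Lemma amul_mono_split i j : amul (mono R i 0) (mono R 0 j) = mono R i j.
Proof. by rewrite amul_mono mulYr_mono. Qed.

Lemma amul1 a : amul a (mono R 0 0) = a.
Proof. by rewrite amul_mono mulYr0. Qed.

Lemma amul1l a : amul (mono R 0 0) a = a.
Proof.
apply: (Aspace_dense (amul (mono R 0 0)) idfun) => [||i j]; [exact: amul_cont|by []|].
by rewrite amul_mono iter_mulXr_mono mulYr_mono addn0.
Qed.

Lemma amul_YX : amul (mono R 0 1) (mono R 1 0) =
  amul (mono R 1 0) (mono R 0 1) + amul (mono R 0 1) (mono R 0 1).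
Proof. by rewrite !amul_mono /= mulYr0 mulXr_mono !mulYr_mono scale1r. Qed.

Lemma iter_amulX i : iter i (amul (mono R 1 0)) (mono R 0 0) = mono R i 0.
Proof.
elim: i => //= i ->; by rewrite amul_mono iter_mulXr_mono mulYr_mono addn1.
Qed.

Lemma iter_amulY j : iter j (amul (mono R 0 1)) (mono R 0 0) = mono R 0 j.
Proof. by elim: j => //= j ->; rewrite amul_mono mulYr_mono. Qed.

End Multiplication.

(** * Submultiplicative seminorms from right multiplication operators *)

Section ArensMichael.
Variable R : realType.
Implicit Types (a b c : Aspace R) (rho : R).

Definition right_bounds rho b : set R :=
  [set C | 0 <= C /\ forall a, nrm R rho (amul R a b) <= C * nrm R rho a]%classic.

(** Right multiplication is used because [nrm_amul] enlarges the radius only for the right factor,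
    so it is bounded from the norm of radius [rho] to itself. *)
Definition opnorm rho b : R := inf (right_bounds rho b).

Lemma opnorm_le rho b (C : R) : right_bounds rho b C -> opnorm rho b <= C.
Proof. by move=> h; apply: ge_inf => //; exists 0 => D []. Qed.

Lemma nrm_right_bounds rho b : 0 < rho -> right_bounds rho b (nrm R (2 * rho) b).
Proof.
move=> r0; split; first by rewrite nrm_ge0 ?mulr_gt0.
by move=> a; rewrite mulrC nrm_amul.
Qed.

Lemma opnorm_ge0 rho b : 0 < rho -> 0 <= opnorm rho b.
Proof.
move=> r0; apply: lb_le_inf; last by move=> C [].
by exists (nrm R (2 * rho) b); apply: nrm_right_bounds.
Qed.

Lemma nrm_amul_opnorm rho a b : 0 < rho -> nrm R rho (amul R a b) <= opnorm rho b * nrm R rho a.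
Proof.
(* When [a] has norm 0 one cannot divide by it; there [nrm_amul] already makes the product vanish in
   norm. *)
move=> r0; have [|a0] := leP (nrm R rho a) 0.
  move=> ha; have /eqP a0 : nrm R rho a == 0 by rewrite eq_le ha nrm_ge0.
  rewrite a0 mulr0; have := nrm_amul R rho a b r0; by rewrite a0 mul0r.
rewrite -ler_pdivrMr //; apply: lb_le_inf.
  by exists (nrm R (2 * rho) b); apply: nrm_right_bounds.
by move=> C [_ h]; rewrite ler_pdivrMr.
Qed.

Lemma seminorm_opnorm rho : 0 < rho -> seminorm (opnorm rho).
Proof.
move=> r0; have sn := seminorm_nrm R rho r0.
apply: seminormP => [b|b c|k b]; first exact: opnorm_ge0.
  apply: opnorm_le; split=> [|a]; first by rewrite addr_ge0 ?opnorm_ge0.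
  rewrite linearD mulrDl; apply: le_trans (seminormD sn _ _) _.
  by rewrite lerD // nrm_amul_opnorm.
apply: opnorm_le; split=> [|a]; first by rewrite mulr_ge0 ?absC_ge0 ?opnorm_ge0.
by rewrite linearZ /= (seminormZ sn) -mulrA ler_wpM2l ?absC_ge0 ?nrm_amul_opnorm.
Qed.

Lemma opnorm_amul rho a b : 0 < rho -> opnorm rho (amul R a b) <= opnorm rho a * opnorm rho b.
Proof.
move=> r0; apply: opnorm_le; split=> [|c]; first by rewrite mulr_ge0 ?opnorm_ge0.
rewrite amulA; apply: le_trans (nrm_amul_opnorm _ _ _ r0) _.
by rewrite [opnorm rho a * _]mulrC -[leRHS]mulrA ler_wpM2l ?opnorm_ge0 ?nrm_amul_opnorm.
Qed.

(** Test the operator on the unit, whose norm is at most 1. *)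
Lemma nrm_le_opnorm rho b : 0 < rho -> nrm R rho b <= opnorm rho b.
Proof.
move=> r0; rewrite -{1}[b]amul1l; apply: le_trans (nrm_amul_opnorm _ _ _ r0) _.
rewrite -[leRHS]mulr1 ler_wpM2l ?opnorm_ge0 //.
by apply: le_trans (nrm_mono_le _ _ _ _ r0) _; rewrite /wt expr0 fact0 divr1.
Qed.

Lemma normAs_AM : is_AM (fun a b => amul R a b) (@normAs R).
Proof.
split; [exact: seminorm_normAs|exact: normAs_hausdorff|exact: normAs_complete|].
exists (posR R), (fun sigma : posR R => opnorm (sval sigma)); split.
- by move=> [rho r0]; apply: seminorm_opnorm.
- by move=> [rho r0] a b; apply: opnorm_amul.
(* The two families define the same topology because the identity is bounded both ways, from
   [nrm rho <= opnorm rho <= nrm (2 * rho)]. *)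
move=> U; split=> oU.
- apply: (@bounded_sn_continuous _ _ _ _ _ _ (@normAs R) idfun) oU => //.
    move=> [rho r0]; exists (exist _ rho r0), 1 => a.
    by rewrite mul1r; apply: nrm_le_opnorm.
  by move=> [rho r0] a; apply: opnorm_ge0.
- apply: (@bounded_sn_continuous _ _ _ _ _ _ (fun sigma : posR R => opnorm (sval sigma)) idfun) oU => //.
    move=> [rho r0]; have r20 : 0 < 2 * rho by rewrite mulr_gt0.
    exists (exist _ (2 * rho) r20), 1 => a.
    by rewrite mul1r; apply: opnorm_le; apply: nrm_right_bounds.
  by move=> i a; apply: (seminorm_ge0 (seminorm_normAs R i)).
Qed.

End ArensMichael.

(** * The universal property *)

Section JordanPair.
Context {R : realType} {B : algType R[i]} {X Y : B}.
Hypothesis XY : Y * X = X * Y + Y * Y.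

Lemma exprYX j : Y ^+ j * X = X * Y ^+ j + Y ^+ j.+1 *+ j.
Proof.
elim: j => [|j IH]; first by rewrite !expr0 mul1r mulr1 mulr0n addr0.
rewrite [in LHS]exprS -mulrA IH mulrDr mulrA XY mulrDl -!mulrA -!exprS.
by rewrite mulrnAr -exprS -addrA -mulrS.
Qed.

Context {q : B -> R}.
Hypotheses (sq : seminorm q) (qM : forall a b, q (a * b) <= q a * q b).

Lemma seminorm_exprS j : j%:R * q (Y ^+ j.+1) <= 2 * q X * q (Y ^+ j).
Proof.
have -> : j%:R * q (Y ^+ j.+1) = q (Y ^+ j * X - X * Y ^+ j).
  by rewrite exprYX addrC addKr -scaler_nat (seminormZ sq) absC_nat.
apply: le_trans (seminormB sq _ _) _.
have := qM (Y ^+ j) X; have := qM X (Y ^+ j); lra.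
Qed.

Lemma exprXY_bound : exists C rho : R, 0 < rho /\
  forall i j, q (X ^+ i * Y ^+ j) <= C * wt rho i j.
Proof.
have q0 := seminorm_ge0 sq.
(* The term [q 1] is included because a submultiplicative seminorm need not satisfy [q 1 <= 1]. *)
pose K := 1 + q 1 + q X + q Y.
have [K1 Ko KX KY] : [/\ 1 <= K, q 1 <= K, q X <= K & q Y <= K].
  by have := q0 1; have := q0 X; have := q0 Y; rewrite /K; split; lra.
have K0 : 0 < 4 * K by lra.
have Xi i : q (X ^+ i) <= K * (4 * K) ^+ i.
  elim: i => [|i IH]; first by rewrite !expr0 mulr1.
  rewrite !exprS mulrCA; apply: le_trans (qM _ _) _; apply: ler_pM => //; lra.
(* For [j >= 1], [j + 1 <= 2 j] turns [seminorm_exprS] into [(j+1) q(Y^(j+1)) <= 4 K q(Y^j)], whence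
   the constant [4 * K]. At [j = 0] that estimate is empty, and [q Y <= K] is used directly. *)
have Yj j : q (Y ^+ j) <= K * ((4 * K) ^+ j / j`!%:R).
  elim: j => [|j IH]; first by rewrite !expr0 fact0 divr1 mulr1.
  have [->|j0] := posnP j; first by rewrite expr1 divr1; nra.
  have -> : K * ((4 * K) ^+ j.+1 / (j.+1)`!%:R) =
      4 * K * (K * ((4 * K) ^+ j / j`!%:R)) / j.+1%:R.
    by rewrite exprS factS natrM invfM; ring.
  rewrite ler_pdivlMr ?ltr0n //.
  have h1 := seminorm_exprS j.
  have h2 : 2 * q X * q (Y ^+ j) <= 2 * K * (K * ((4 * K) ^+ j / j`!%:R)).
    by apply: ler_pM => //; [rewrite mulr_ge0|rewrite ler_pM2l].
  have h3 : (1 : R) <= j%:R by rewrite ler1n.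
  have := q0 (Y ^+ j.+1); rewrite -natr1; nra.
exists (K * K), (4 * K); split=> // i j; apply: le_trans (qM _ _) _.
have -> : K * K * wt (4 * K) i j =
    K * (4 * K) ^+ i * (K * ((4 * K) ^+ j / j`!%:R)) by rewrite /wt exprD; ring.
by apply: ler_pM.
Qed.

End JordanPair.

Section UniversalProperty.
Context {R : realType} {B : algType R[i]} {J : Type} {q : J -> B -> R}.
Hypotheses (sq : forall j, seminorm (q j)) (hq : sn_hausdorff q) (cq : sn_complete q).
Hypothesis qM : forall j a b, q j (a * b) <= q j a * q j b.
Context {X Y : B}.
Hypothesis XY : Y * X = X * Y + Y * Y.

Let dense := dense_mono_eq sq hq.

Lemma mull_is_linear (z : B) : linear (fun a : B => z * a).
Proof. by move=> k a b; rewrite mulrDr scalerAr. Qed.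

Lemma mulr_is_linear (z : B) : linear (fun a : B => a * z).
Proof. by move=> k a b; rewrite mulrDl scalerAl. Qed.

Let mull z : {linear B -> B} := HB.pack (fun a : B => z * a)
  (GRing.isLinear.Build _ _ _ _ (fun a : B => z * a) (mull_is_linear z)).
Let mulr z : {linear B -> B} := HB.pack (fun a : B => a * z)
  (GRing.isLinear.Build _ _ _ _ (fun a : B => a * z) (mulr_is_linear z)).

Lemma mull_cont z : sn_continuous q q (mull z).
Proof.
apply: bounded_sn_continuous => [a b|j|j a]; first exact: raddfB.
  by exists j, (q j z) => a; apply: qM.
exact: seminorm_ge0.
Qed.

Lemma mulr_cont z : sn_continuous q q (mulr z).
Proof.
apply: bounded_sn_continuous => [a b|j|j a]; first exact: raddfB.
  by exists j, (q j z) => a; rewrite mulrC; apply: qM.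
exact: seminorm_ge0.
Qed.

Lemma universal_hom : exists f : {linear Aspace R -> B},
  [/\ sn_continuous (@normAs R) q f,
      forall i j, f (mono R i j) = X ^+ i * Y ^+ j &
      forall a b, f (amul R a b) = f a * f b].
Proof.
have [|f [fm fb]] := extension_exists sq hq cq (fun i j => X ^+ i * Y ^+ j).
  by move=> j; apply: exprXY_bound.
have cf : sn_continuous (@normAs R) q f.
  apply: linear_cont => j.
  have [C [rho [r0 hC]]] := exprXY_bound XY (sq j) (qM j).
  by exists rho, C; split=> // a; apply: fb.
exists f; split=> // a b.
(* Multiplicativity is proved by density, first for a right factor [y^l], then [x], then any [b]
   through its monomials. *)
have fY l c : f (mulYr R l c) = f c * Y ^+ l.
  apply: (dense (f \o mulYr R l) (mulr (Y ^+ l) \o f)) => [||i j] /=.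
  - exact: sn_continuous_comp cf (mulYr_cont R l).
  - exact: sn_continuous_comp (mulr_cont _) cf.
  by rewrite mulYr_mono !fm exprD mulrA.
have fX c : f (mulXr R c) = f c * X.
  apply: (dense (f \o mulXr R) (mulr X \o f)) => [||i j] /=.
  - exact: sn_continuous_comp cf (mulXr_cont R).
  - exact: sn_continuous_comp (mulr_cont _) cf.
  rewrite mulXr_mono linearD linearZ /= !fm -mulrA (exprYX XY) mulrDr mulrA -exprSr.
  by rewrite scaler_nat mulrnAr.
apply: (dense (f \o amul R a) (mull (f a) \o f)) => [||i j] /=.
- exact: sn_continuous_comp cf (amul_cont R a).
- exact: sn_continuous_comp (mull_cont _) cf.
rewrite amul_mono fY fm mulrA; congr (_ * _).
by elim: i => [|i IH]; rewrite ?mulr1 //= fX IH -mulrA -exprSr.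
Qed.

(** Multiplicativity and the values at [1], [x], [y] determine [g] on all monomials, and density
    does the rest. *)
Lemma universal_hom_unique (f g : {linear Aspace R -> B}) :
  sn_continuous (@normAs R) q f -> sn_continuous (@normAs R) q g ->
  (forall i j, f (mono R i j) = X ^+ i * Y ^+ j) ->
  (forall a b, g (amul R a b) = g a * g b) -> g (mono R 0 0) = 1 ->
  g (mono R 1 0) = X -> g (mono R 0 1) = Y -> f =1 g.
Proof.
move=> cf cg fm gM g1 gX gY; apply: dense => // i j.
rewrite fm -amul_mono_split gM -(iter_amulX R i) -(iter_amulY R j); congr (_ * _).
  by elim: i => /= [|i IH]; [rewrite g1|rewrite gM gX -IH exprS].
by elim: j => /= [|j IH]; [rewrite g1|rewrite gM gY -IH exprS].
Qed.

End UniversalProperty.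

Theorem mainTheorem3 (R : realType) :
  exists (mul : Aspace R -> Aspace R -> Aspace R) (one x y : Aspace R),
    (* the unit and the generators x, y (coefficient families) *)
    (aval one = delta R 0 0 /\ aval x = delta R 1 0 /\ aval y = delta R 0 1) /\
    (* mul is an associative, unital, bilinear multiplication *)
    ((forall a b c, mul a (mul b c) = mul (mul a b) c) /\
     (forall a, mul one a = a) /\ (forall a, mul a one = a) /\
     (forall a b c, mul (a + b) c = mul a c + mul b c) /\
     (forall a b c, mul a (b + c) = mul a b + mul a c) /\
     (forall (k : R[i]) a b, mul (k *: a) b = k *: mul a b) /\
     (forall (k : R[i]) a b, mul a (k *: b) = k *: mul a b)) /\
    (* it is determined by the relation y x = x y + y^2, the monomial
       x^i y^j having coefficient family delta i j *)
    mul y x = mul x y + mul y y /\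
    (forall i j : nat,
       aval (mul (iter i (mul x) one) (iter j (mul y) one)) = delta R i j) /\
    (* with the topology of the family {||.||_rho : rho > 0}, it is an
       Arens-Michael algebra *)
    is_AM mul (@normAs R) /\
    (* universal property of the Arens-Michael envelope of Lambda_2,
       iota : x |-> x, y |-> y; unital homomorphisms Lambda_2 -> B are
       given by pairs X, Y in B with Y X = X Y + Y^2 *)
    (forall (B : algType R[i]) (I : Type) (p : I -> B -> R),
       is_AM (@GRing.mul B) p ->
       forall X Y : B, Y * X = X * Y + Y * Y ->
       exists! f : Aspace R -> B,
         (forall a b, f (a + b) = f a + f b) /\
         (forall (k : R[i]) a, f (k *: a) = k *: f a) /\
         (forall a b, f (mul a b) = f a * f b) /\
         f one = 1 /\
         sn_continuous (@normAs R) p f /\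
         f x = X /\ f y = Y).
Proof.
exists (fun a b => amul R a b), (mono R 0 0), (mono R 1 0), (mono R 0 1).
split; first by [].
split.
  split; first exact: amulA.
  split; first exact: amul1l.
  split; first exact: amul1.
  split; first by move=> a b c; have := amul_linearl R 1 a b c; rewrite !scale1r.
  split; first by move=> a b c; rewrite linearD.
  split; last by move=> k a b; rewrite linearZ.
  (* The second instance reads [0 b = 0 b + 0 b]; cancelling gives [0 b = 0], which removes the
     extra summand from the first. *)
  move=> k a b; have := amul_linearl R k a 0 b; have := amul_linearl R 1 0 0 b.
  by rewrite !scale1r !addr0 -[LHS]addr0 => /addrI <-; rewrite addr0.
split; first exact: amul_YX.
split; first by move=> i j; rewrite iter_amulX iter_amulY amul_mono_split.
split; first exact: normAs_AM.
(* The construction runs with the submultiplicative family [q]; continuity passes between [p] and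
   [q] as their open sets coincide. *)
move=> B I p [sp hp cp [J [q [sq qM pq]]]] X Y XY.
have hq := same_topology_hausdorff sp pq hp.
have cq := same_topology_complete sp pq cp.
have [f [cf fm fM]] := universal_hom sq hq cq qM XY.
exists f; split.
  split; first exact: raddfD.
  split; first by move=> k a; rewrite linearZ.
  split; first exact: fM.
  split; first by rewrite fm mulr1.
  split; first by move=> U /pq; apply: cf.
  by rewrite !fm mulr1 mul1r.
move=> g [gD [gZ [gM [g1 [cg [gX gY]]]]]].
have glin : linear g by move=> k a b; rewrite gD gZ.
pose gl : {linear Aspace R -> B} := HB.pack g (GRing.isLinear.Build _ _ _ _ g glin).
apply/funext; apply: (universal_hom_unique sq hq f gl cf _ fm gM g1 gX gY).
by move=> U /pq; apply: cg.
Qed.
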